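(* Let $n\ge 1$ and let $X=\{\sigma_1,\dots,\sigma_K\}$ be a finite simplicial complex in $\mathbb{R}^n$ such that every $k$-simplex of $X$ with $k<n$ is a face of an $n$-simplex of $X$, the set $|X|$ is convex, and $X_k=\{\sigma_1,\dots,\sigma_k\}$ is a subcomplex of $X$ for every $1\le k\le K$. Let $\mathbb{X}: \emptyset=X_0\subset X_1\subset\cdots\subset X_K=X$, with homology coefficients in $\mathbb{Z}_2=\mathbb{Z}/2\mathbb{Z}$. If $z_i$ and $z_j$ are the optimal volumes for two different birth-death pairs $(b_i,d_i)$ and $(b_j,d_j)$ in $D_{n-1}(\mathbb{X})$ with finite death times, then one of the following holds: $z_i\cap z_j=\emptyset$, or $z_i\subset z_j$, or $z_i\supset z_j$. Here a chain $z=\sum_{\sigma\ n\text{-simplex}}k_\sigma\sigma\in C_n(X)$ is regarded as the set of $n$-simplices $\{\sigma\mid k_\sigma\ne 0\}$.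
   Context: $|X|\subset\mathbb{R}^n$ is the union of the simplices of $X$. Coefficients are in $\mathbb{Z}_2$. The persistent homology $H_{n-1}(\mathbb{X})$ is the family $H_{n-1}(X_k)$, $0\le k\le K$, with the maps induced by inclusions. It decomposes uniquely as $\bigoplus_{i=1}^p I(b_i,d_i)$ with $b_i<d_i\le\infty$, where the interval module $I(b,d)$ is $\mathbb{Z}_2$ at indices $k$ with $b\le k<d$ and $0$ elsewhere, with identity maps between the nonzero spaces and zero maps otherwise. The persistence diagram is $D_{n-1}(\mathbb{X})=\{(b_i,d_i)\mid i=1,\dots,p\}$. For an $(n-1)$-simplex $\sigma_k$, let $\sigma_k^*$ be the linear functional on $C_{n-1}(X)$ with $\sigma_k^*(\sigma_j)=\delta_{kj}$ for all $(n-1)$-simplices $\sigma_j$. For $(b_i,d_i)\in D_{n-1}(\mathbb{X})$ with $d_i<\infty$ put $\mathcal{F}_m=\{\sigma_k \ m\text{-simplex}\mid b_i<k<d_i\}$. A chain $z\in C_n(X)$ is a persistent volume for $(b_i,d_i)$ if: (1) $z=\sigma_{d_i}+\sum_{\sigma_k\in\mathcal{F}_n}\alpha_k\sigma_k$ for some $\alpha_k\in\mathbb{Z}_2$; (2) $\tau^*(\partial z)=0$ for all $\tau\in\mathcal{F}_{n-1}$; (3) $\sigma_{b_i}^*(\partial z)\ne 0$. An optimal volume for $(b_i,d_i)$ is a persistent volume $z$ minimizing $\|z\|_0$, the number of $n$-simplices with nonzero coefficient in $z$, among all persistent volumes for $(b_i,d_i)$. (In the present setting it is unique.) *)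

(* Defs.v *)
From HB Require Import structures.
From mathcomp Require Import all_boot all_order all_algebra finmap.
From mathcomp Require Import generic_quotient ring_quotient.
From mathcomp Require Import classical_sets reals convex.

Set Implicit Arguments.
Unset Strict Implicit.
Unset Printing Implicit Defensive.

Import GRing.Theory.
Local Open Scope ring_scope.
Local Open Scope quotient_scope.

(* MathComp only gives [Quotient.quot W] a Z-module structure; it becomes an
   F-vector space when W is a subspace of an F-vector space. *)

Section QuotientSpace.
Variables (F : fieldType) (V : vectType F) (W : {vspace V}).

Definition quot_space : Type := Quotient.quot (pred_of_vspace W).
HB.instance Definition _ := GRing.Zmodule.on quot_space.
HB.instance Definition _ := EqQuotient.on quot_space.

Definition quot_pi (x : V) : quot_space := \pi_quot_space x.

Lemma quot_pi_eq x y : quot_pi x = quot_pi y <-> x - y \in W.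
Proof.
rewrite /quot_pi; split; last by move=> h; apply/eqP; rewrite -Quotient.idealrBE.
by move/eqP; rewrite -Quotient.idealrBE.
Qed.

Lemma quot_piB : {morph quot_pi : x y / x - y}.
Proof. by move=> x y; rewrite /quot_pi raddfB. Qed.

Lemma quot_piD : {morph quot_pi : x y / x + y}.
Proof. by move=> x y; rewrite /quot_pi raddfD. Qed.

Lemma quot_reprK (x : quot_space) : quot_pi (repr x) = x.
Proof. exact: reprK. Qed.

Definition quot_scale (a : F) (x : quot_space) : quot_space :=
  quot_pi (a *: repr x).

Lemma quot_piZ a x : quot_pi (a *: x) = quot_scale a (quot_pi x).
Proof.
apply/quot_pi_eq; rewrite -scalerBr memvZ //.
by apply/quot_pi_eq; rewrite quot_reprK.
Qed.

Fact quot_scaleA a b x : quot_scale a (quot_scale b x) = quot_scale (a * b) x.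
Proof. by rewrite -[x]quot_reprK -!quot_piZ scalerA. Qed.

Fact quot_scale1 : left_id 1 quot_scale.
Proof. by move=> x; rewrite -[x]quot_reprK -quot_piZ scale1r. Qed.

Fact quot_scaleDr : right_distributive quot_scale +%R.
Proof.
by move=> a x y; rewrite -[x]quot_reprK -[y]quot_reprK -quot_piD -!quot_piZ
  scalerDr quot_piD.
Qed.

Fact quot_scaleDl x : {morph quot_scale^~ x : a b / a + b}.
Proof. by move=> a b; rewrite -[x]quot_reprK -!quot_piZ scalerDl quot_piD. Qed.

HB.instance Definition _ := GRing.Zmodule_isLmodule.Build F quot_space
  quot_scaleA quot_scale1 quot_scaleDr quot_scaleDl.

Fact quot_pi_linear : linear quot_pi.
Proof. by move=> a x y; rewrite quot_piD quot_piZ. Qed.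

HB.instance Definition _ := GRing.isLinear.Build F V quot_space _ quot_pi
  quot_pi_linear.

End QuotientSpace.

Section QuotientMap.
Variables (F : fieldType) (V V' : vectType F) (W : {vspace V}) (W' : {vspace V'}).
Variables (f : {linear V -> V'}) (fW : forall x, x \in W -> f x \in W').

Definition quot_map_fun of (forall x, x \in W -> f x \in W') :=
  fun x : quot_space W => quot_pi W' (f (repr x)).

Lemma quot_map_pi x : quot_map_fun fW (quot_pi W x) = quot_pi W' (f x).
Proof.
apply/quot_pi_eq; rewrite -linearB fW //.
by apply/quot_pi_eq; rewrite quot_reprK.
Qed.

Fact quot_map_linear : linear (quot_map_fun fW).
Proof.
move=> a x y; rewrite -[x]quot_reprK -[y]quot_reprK -linearP !quot_map_pi.
by rewrite !linearP.
Qed.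

HB.instance Definition _ := GRing.isLinear.Build F _ _ _ (quot_map_fun fW)
  quot_map_linear.

Definition quot_map : {linear quot_space W -> quot_space W'} := quot_map_fun fW.

End QuotientMap.

Record persmod (F : fieldType) (K : nat) := Persmod {
  pm_space :> 'I_K.+1 -> lmodType F;
  pm_map : forall j k : 'I_K.+1, (j <= k)%N ->
    {linear pm_space j -> pm_space k};
  pm_map_id : forall (k : 'I_K.+1) (h : (k <= k)%N), pm_map h =1 id;
  pm_map_comp : forall (j k l : 'I_K.+1) (hjk : (j <= k)%N) (hkl : (k <= l)%N)
    (hjl : (j <= l)%N), pm_map hkl \o pm_map hjk =1 pm_map hjl }.

Definition pm_iso (F : fieldType) (K : nat) (M N : persmod F K) : Prop :=
  exists f : forall k : 'I_K.+1, {linear M k -> N k},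
    (forall k, bijective (f k)) /\
    (forall (j k : 'I_K.+1) (h : (j <= k)%N) (x : M j),
       f k (pm_map M h x) = pm_map N h (f j x)).

Section DirectSum.
Variables (F : fieldType) (K : nat).

Definition pm_zero : persmod F K :=
  @Persmod F K (fun=> 'rV[F]_0) (fun _ _ _ => idfun)
    (fun _ _ _ => erefl) (fun _ _ _ _ _ _ _ => erefl).

Section Binary.
Variables M N : persmod F K.

Definition pm_sum_fun (j k : 'I_K.+1) (h : (j <= k)%N) (x : M j * N j) :=
  (pm_map M h x.1, pm_map N h x.2).

Fact pm_sum_fun_linear (j k : 'I_K.+1) (h : (j <= k)%N) : linear (@pm_sum_fun j k h).
Proof. by move=> a x y; rewrite /pm_sum_fun /= !linearP. Qed.

HB.instance Definition _ (j k : 'I_K.+1) (h : (j <= k)%N) :=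
  GRing.isLinear.Build F (M j * N j)%type (M k * N k)%type _ (@pm_sum_fun j k h)
    (pm_sum_fun_linear h).

Fact pm_sum_id (k : 'I_K.+1) (h : (k <= k)%N) : pm_sum_fun h =1 id.
Proof. by case=> x y; rewrite /pm_sum_fun /= !pm_map_id. Qed.

Fact pm_sum_comp (j k l : 'I_K.+1) (hjk : (j <= k)%N) (hkl : (k <= l)%N)
  (hjl : (j <= l)%N) : pm_sum_fun hkl \o pm_sum_fun hjk =1 pm_sum_fun hjl.
Proof.
case=> x y; rewrite /pm_sum_fun /=.
by rewrite -(pm_map_comp hjk hkl hjl) -(pm_map_comp hjk hkl hjl).
Qed.

Definition pm_sum : persmod F K :=
  @Persmod F K (fun k => (M k * N k)%type)
    (fun j k h => pm_sum_fun h : {linear _ -> _}) pm_sum_id pm_sum_comp.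

End Binary.

Definition pm_bigsum (s : seq (persmod F K)) : persmod F K :=
  foldr pm_sum pm_zero s.

End DirectSum.

(* A death time is [Some d] when finite and [None] when infinite. *)

Definition alive (b : nat) (d : option nat) (k : nat) : bool :=
  (b <= k)%N && (if d is Some e then (k < e)%N else true).

(* At index k, the interval module is the space of row vectors of length
   [alive b d k], the boolean being read as 0 or 1; [pid_mx 1] is then the
   identity matrix between nonzero spaces, and an empty matrix otherwise. *)

Section Interval.
Variables (F : fieldType) (K : nat) (b : nat) (d : option nat).

Definition interval_fun (j k : 'I_K.+1) of (j <= k)%N :
    {linear 'rV[F]_(alive b d j) -> 'rV[F]_(alive b d k)} :=
  mulmxr (pid_mx 1).

Fact interval_id (k : 'I_K.+1) (h : (k <= k)%N) : interval_fun h =1 id.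
Proof.
rewrite /interval_fun; case: (alive b d k) => x /=.
  by rewrite pid_mx_1 mulmx1.
by rewrite [x]thinmx0 mul0mx.
Qed.

Fact interval_comp (j k l : 'I_K.+1) (hjk : (j <= k)%N) (hkl : (k <= l)%N)
  (hjl : (j <= l)%N) : interval_fun hkl \o interval_fun hjk =1 interval_fun hjl.
Proof.
move=> x; rewrite /interval_fun /= -mulmxA mul_pid_mx.
case hk: (alive b d k) => //=; rewrite min0n.
case hj: (alive b d j) x => x /=; last by rewrite [x]thinmx0 !mul0mx.
case hl: (alive b d l); last by rewrite [LHS]thinmx0 [RHS]thinmx0.
move: hj hk hl; rewrite /alive => /andP[bj _].
rewrite (leq_trans bj hjk) /= => hk /andP[_ hl].
by case: (d) hk hl => [e|//] /negbT hk /(leq_ltn_trans hkl); rewrite (negbTE hk).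
Qed.

Definition interval_module : persmod F K :=
  @Persmod F K (fun k => 'rV[F]_(alive b d k)) interval_fun
    interval_id interval_comp.

End Interval.

(* The conditions b <= K and d <= K make the decomposition unique: over the
   index range 0 <= k <= K, I(b, K + 1) would be the same module as
   I(b, +oo). *)

Definition is_persistence_diagram (F : fieldType) (K : nat) (M : persmod F K)
    (D : seq (nat * option nat)) : Prop :=
  (forall b d, (b, d) \in D ->
     (b <= K)%N /\ (if d is Some e then (b < e <= K)%N else true)) /\
  pm_iso M (pm_bigsum [seq interval_module F K bd.1 bd.2 | bd <- D]).

(* A complex with simplices sigma_1, ..., sigma_K, listed in the order of the
   filtration, is a function [s] on ['I_K], with sigma_k = s i for k = i + 1.
   Chains, of all dimensions, are row vectors over F_2; coordinate i is the
   coefficient of sigma_(i + 1). *)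

Section Chains.
Variables (T : choiceType) (K : nat) (s : 'I_K -> {fset T}).

Definition is_simplex_of_dim (m : nat) (i : 'I_K) : bool :=
  #|` s i| == m.+1.

Definition is_facet (j i : 'I_K) : bool :=
  (s j `<=` s i)%fset && (#|` s i| == #|` s j|.+1).

Definition boundary : 'End('rV['F_2]_K) :=
  linfun (mulmxr (\matrix_(i, j) (is_facet j i)%:R)).

(* C_m(X_k) *)
Definition chains (m k : nat) : {vspace 'rV['F_2]_K} :=
  (\sum_(i < K | is_simplex_of_dim m i && (i < k)%N)
     <[delta_mx 0%R i : 'rV['F_2]_K]>)%VS.

Definition cycles (m k : nat) : {vspace 'rV['F_2]_K} :=
  (chains m k :&: lker boundary)%VS.

Definition boundaries (m k : nat) : {vspace 'rV['F_2]_K} :=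
  (boundary @: chains m.+1 k)%VS.

Definition boundaries_in_cycles (m k : nat) : {vspace subvs_of (cycles m k)} :=
  (linfun vsval @^-1: boundaries m k)%VS.

Definition homology (m k : nat) : lmodType 'F_2 :=
  quot_space (boundaries_in_cycles m k).

Lemma chainsS m j k : (j <= k)%N -> (chains m j <= chains m k)%VS.
Proof.
move=> jk; apply/subv_sumP => i /andP[hi ij].
by apply: (sumv_sup i) => //; rewrite hi (leq_trans ij jk).
Qed.

Lemma cyclesS m j k : (j <= k)%N -> (cycles m j <= cycles m k)%VS.
Proof. by move=> jk; apply: capvS => //; apply: chainsS. Qed.

Lemma boundariesS m j k : (j <= k)%N -> (boundaries m j <= boundaries m k)%VS.
Proof. by move=> jk; apply: limgS; apply: chainsS. Qed.

(* When j <= k, this is the inclusion of Z_m(X_j) in Z_m(X_k). *)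
Definition cycle_incl (m j k : nat) :
    {linear subvs_of (cycles m j) -> subvs_of (cycles m k)} :=
  vsproj (cycles m k) \o vsval.

Lemma cycle_inclE m j k (x : subvs_of (cycles m j)) : (j <= k)%N ->
  vsval (cycle_incl m j k x) = vsval x.
Proof.
by move=> jk; rewrite /= vsprojK // (subvP (cyclesS m jk)) // subvsP.
Qed.

Lemma cycle_incl_boundaries m j k : (j <= k)%N ->
  forall x, x \in boundaries_in_cycles m j ->
    cycle_incl m j k x \in boundaries_in_cycles m k.
Proof.
move=> jk x; rewrite -!memv_preim !lfunE /= => hx.
rewrite -[vsval _]/(vsval (cycle_incl m j k x)) cycle_inclE //.
exact: (subvP (boundariesS m jk)).
Qed.

Definition homology_map (m j k : nat) (h : (j <= k)%N) :
    {linear homology m j -> homology m k} :=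
  quot_map (cycle_incl_boundaries (m := m) h).

Fact homology_map_id m (k : 'I_K.+1) (h : (k <= k)%N) :
  homology_map m h =1 id.
Proof.
move=> x; rewrite -[x]quot_reprK [LHS]quot_map_pi; congr quot_pi.
by apply: val_inj; apply: cycle_inclE.
Qed.

Fact homology_map_comp m (j k l : 'I_K.+1) (hjk : (j <= k)%N)
  (hkl : (k <= l)%N) (hjl : (j <= l)%N) :
  homology_map m hkl \o homology_map m hjk =1 homology_map m hjl.
Proof.
move=> x; rewrite -[x]quot_reprK /= !quot_map_pi; congr quot_pi.
by apply: val_inj; rewrite ![\val _]cycle_inclE.
Qed.

Definition persistent_homology (m : nat) : persmod 'F_2 K :=
  @Persmod 'F_2 K (fun k => homology m k) (fun j k h => homology_map m h)
    (@homology_map_id m) (@homology_map_comp m).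

(* sigma_k, as a chain *)
Definition simplex_chain (k : nat) : 'rV['F_2]_K := \row_i (i.+1 == k)%:R.

(* The functional sigma_k^* *)
Definition simplex_coef (k : nat) (z : 'rV['F_2]_K) : 'F_2 :=
  \sum_(i < K | i.+1 == k) z 0 i.

(* The set of indices i of the m-simplices sigma_k = s i with b < k < d *)
Definition simplices_between (m b d : nat) : {set 'I_K} :=
  finset (fun i : 'I_K => is_simplex_of_dim m i && (b < i.+1 < d)%N).

Definition is_persistent_volume (n b d : nat) (z : 'rV['F_2]_K) : Prop :=
  [/\ z \in chains n K,
      exists a : 'I_K -> 'F_2,
        z = simplex_chain d +
            \sum_(i in simplices_between n b d) a i *: simplex_chain i.+1,
      forall i, i \in simplices_between n.-1 b d ->
        simplex_coef i.+1 (boundary z) = 0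
    & simplex_coef b (boundary z) != 0].

Definition simplices_of_chain (n : nat) (z : 'rV['F_2]_K) : {set 'I_K} :=
  finset (fun i : 'I_K => is_simplex_of_dim n i && (z 0 i != 0)).

Definition is_optimal_volume (n b d : nat) (z : 'rV['F_2]_K) : Prop :=
  is_persistent_volume n b d z /\
  forall z', is_persistent_volume n b d z' ->
    (#|simplices_of_chain n z| <= #|simplices_of_chain n z'|)%N.

End Chains.

Local Open Scope classical_set_scope.

(* A simplex of R^n is given by its nonempty finite set of vertices. *)

Section Geometry.
Variables (R : realType) (n : nat).

Definition affinely_independent (v : {fset 'rV[R]_n}) : Prop :=
  forall c : 'rV[R]_n -> R,
    \sum_(x <- v) c x = 0 -> \sum_(x <- v) c x *: x = 0 ->
    forall x, x \in v -> c x = 0.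

Definition hull (v : {fset 'rV[R]_n}) : set 'rV[R]_n :=
  [set p | exists w : 'rV[R]_n -> R,
     [/\ forall x, x \in v -> 0 <= w x,
         \sum_(x <- v) w x = 1
       & p = \sum_(x <- v) w x *: x]].

(* In the last condition, t may be empty, and then [hull t] is empty. *)
Definition is_simplicial_complex (X : set {fset 'rV[R]_n}) : Prop :=
  [/\ forall v, X v -> v <> fset0 /\ affinely_independent v,
      forall v t, X v -> (t `<=` v)%fset -> t <> fset0 -> X t
    & forall v v', X v -> X v' ->
        exists t, [/\ (t `<=` v)%fset, (t `<=` v')%fset
                    & hull v `&` hull v' = hull t]].

Definition is_subcomplex (Y X : set {fset 'rV[R]_n}) : Prop :=
  Y `<=` X /\ is_simplicial_complex Y.

Definition polyhedron (X : set {fset 'rV[R]_n}) : set 'rV[R]_n :=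
  \bigcup_(v in X) hull v.

Definition is_pure (X : set {fset 'rV[R]_n}) : Prop :=
  forall v, X v -> (#|` v| < n.+1)%N ->
    exists v', [/\ X v', #|` v'| = n.+1 & (v `<=` v')%fset].

(* X_k = {sigma_1, ..., sigma_k} *)
Definition stage (K : nat) (s : 'I_K -> {fset 'rV[R]_n}) (k : nat) :
    set {fset 'rV[R]_n} :=
  [set s i | i in [set i : 'I_K | (i < k)%N]].

End Geometry.

(* Main.v *)
Require Import Defs.
From mathcomp Require Import all_boot all_order all_algebra finmap.
From mathcomp Require Import classical_sets reals convex.
From mathcomp Require Import ring lra.

Set Implicit Arguments.
Unset Strict Implicit.
Unset Printing Implicit Defensive.

Import Order.TTheory GRing.Theory Num.Theory.

(** Consider the dual graph of the complex: its vertices are the n-simplices,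
    and every (n-1)-simplex joins the n-simplices of which it is a facet.
    Keep only the edges of filtration index > b. The point is that the optimal
    volume of a pair (b, d) is exactly the connected component C of sigma_d in
    this graph ([optimal_volume_component]).

    Let z be an optimal volume. In R^n, an (n-1)-simplex is a facet of at most
    two n-simplices ([no_three_cofaces]), so the vanishing of tau^*(dz) for an
    edge tau says that tau does not separate a simplex of z from one outside
    z. Edges of index >= d are not facets of simplices of z, because a facet
    precedes its cofaces. Hence z is closed under adjacency and contains C.
    Let z_C be z restricted to C. An edge of index > b has either all its
    cofaces in C or none, so its coefficient in the boundary of z_C vanishes
    too.

    It remains to see that sigma_b occurs in the boundary of z_C, for then z_C
    is a persistent volume and minimality gives z = z_C. Otherwise w = z - z_C
    is a chain of X_(d-1) whose boundary lies in X_b and contains sigma_b. But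
    then every cycle of X_b is, modulo that boundary, a cycle of X_(b-1), so
    that H(X_b) and H(X_(b-1)) have the same image in H(X_(d-1)). This is
    impossible when I(b, d) is a summand, since its generator is born at b and
    is still alive at d - 1 ([born_cycle_not_killed_before]).

    Finally, for b <= b' the graph of threshold b' is a subgraph of the one of
    threshold b, so a component of the former lies inside a component of the
    latter or is disjoint from it. *)

(** * Simplices of R^n sharing a facet *)

Section AffineGeometry.
Local Open Scope fset_scope.
Local Open Scope ring_scope.
Variables (R : realType) (n : nat).
Implicit Types (v t F : {fset 'rV[R]_n}) (a b : 'rV[R]_n).

Definition affine_dependence v (c : 'rV[R]_n -> R) : Prop :=
  \sum_(x <- v) c x = 0 /\ \sum_(x <- v) c x *: x = 0.

(** The vectors (x, 1) lie in a space of dimension n + 1. *)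
Lemma affine_dependence_exists v : (n.+1 < #|` v|)%N ->
  exists2 c, affine_dependence v c & exists2 x, x \in v & c x != 0.
Proof.
set N := size v; move=> hN.
pose A : 'M[R]_(N, n + 1) := \matrix_(i < N) row_mx v`_i 1%:M.
have [u u0 uA] : exists2 u : 'rV[R]_N, u != 0 & u *m A = 0.
  have : ~~ row_free A.
    by rewrite -row_leq_rank -ltnNge (leq_ltn_trans (rank_leq_col A)) // addn1.
  rewrite -kermx_eq0 => /rowV0Pn[u /sub_kermxP uA u0].
  by exists u.
(* [c] transports the coefficients along the enumeration of [v]. *)
pose c x := if insub (index x v) is Some i then u 0 i else 0.
have cE (i : 'I_N) : c v`_i = u 0 i.
  by rewrite /c index_uniq ?fset_uniq // valK.
have sumE (V : nmodType) (G : R -> 'rV[R]_n -> V) :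
    \sum_(x <- v) G (c x) x = \sum_(i < N) G (u 0 i) v`_i.
  rewrite (big_nth 0) big_mkord; by apply: eq_bigr => i _; rewrite cE.
have rowE : \sum_(i < N) u 0 i *: row_mx v`_i (1%:M : 'M[R]_1) = 0.
  rewrite -[RHS]uA mulmx_sum_row; apply: eq_bigr => i _.
  by congr (_ *: _); apply/rowP=> j; rewrite !mxE.
exists c.
  split.
    rewrite (sumE _ (fun r _ => r)).
    have /(congr1 rsubmx)/matrixP/(_ 0 0) := rowE.
    rewrite linear_sum summxE linear0 mxE => h; rewrite -[RHS]h.
    by apply: eq_bigr => i _; rewrite linearZ /= row_mxKr !mxE mulr1.
  rewrite (sumE _ (fun r x => r *: x)).
  have /(congr1 lsubmx) := rowE.
  rewrite linear_sum linear0 => h; rewrite -[RHS]h.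
  by apply: eq_bigr => i _; rewrite linearZ /= row_mxKl.
have /rV0Pn[i ui] := u0.
by exists v`_i; rewrite ?cE // mem_nth.
Qed.

(** Coefficients of opposite signs at a and b would put a and b on the same
    side of F, and the two simplices would overlap beyond F. Explicitly, for
    any large M, the dependence rewrites as an equality
    (sum over F of M x) + (- c a) a = (sum over F of (M + c x) x) + (c b) b
    between two nonnegative combinations; after normalization, both describe a
    common point q of the two hulls. The common face t containing q lies in F,
    although q has a positive barycentric coordinate at a. *)
Lemma dependence_sides F a b (c : 'rV[R]_n -> R) :
  a \notin F -> b \notin F -> a != b -> affinely_independent (a |` F) ->
  (exists t, [/\ t `<=` a |` F, t `<=` b |` F
               & classical_sets.setI (hull (a |` F)) (hull (b |` F)) = hull t]) ->
  affine_dependence (a |` (b |` F)) c -> c a < 0 -> c b <= 0.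
Proof.
move=> aF bF ab indep [t [ta tb hullt]] [].
have abF : a \notin b |` F by rewrite !inE negb_or ab.
rewrite !big_fsetU1 //= => sum0 comb0 ca.
rewrite leNgt; apply/negP => cb.
pose M := 1 + \sum_(x <- F) `|c x|.
have cM x : x \in F -> - M <= c x.
  move=> xF; rewrite lerNl; apply: le_trans (ler_norm _) _.
  rewrite ?normrN /M (big_fsetD1 x) //= addrCA lerDl addr_ge0 //.
  exact: sumr_ge0.
have M0 : 0 <= M by rewrite addr_ge0 // sumr_ge0.
pose W := - c a + \sum_(x <- F) M.
have W0 : 0 < W.
  by apply: ltr_wpDr; [apply: sumr_ge0|rewrite oppr_gt0].
have Wn0 : W != 0 by rewrite gt_eqF.
pose wa x := W^-1 * (if x == a then - c a else M).
pose wb x := W^-1 * (if x == b then c b else M + c x).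
have neqF y x : y \notin F -> x \in F -> (x == y) = false.
  by move=> yF xF; apply: contraNF yF => /eqP <-.
pose q := \sum_(x <- a |` F) wa x *: x.
have sumwa : \sum_(x <- a |` F) wa x = 1.
  rewrite -mulr_sumr big_fsetU1 //= eqxx.
  by rewrite (eq_big_seq (fun=> M)) ?mulVf // => x xF; rewrite (neqF a).
have sumwb : \sum_(x <- b |` F) wb x = 1.
  rewrite -mulr_sumr big_fsetU1 //= eqxx.
  rewrite (eq_big_seq (fun x => M + c x)) => [|x xF]; last by rewrite (neqF b).
  rewrite big_split /=.
  have -> : c b + (\sum_(i <- F) M + \sum_(i <- F) c i) = W.
    by rewrite /W; move: sum0; set s1 := \sum_(i <- F) c i; lra.
  by rewrite mulVf.
have qb : q = \sum_(x <- b |` F) wb x *: x.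
  rewrite /q.
  under eq_bigr do rewrite -scalerA.
  under [RHS]eq_bigr do rewrite -scalerA.
  rewrite -!scaler_sumr !big_fsetU1 //= !eqxx; congr (_ *: _).
  rewrite (eq_big_seq (fun x => M *: x)) => [|x xF]; last by rewrite (neqF a).
  rewrite [in RHS](eq_big_seq (fun x => M *: x + c x *: x)) => [|x xF]; last first.
    by rewrite (neqF b x bF xF) scalerDl.
  rewrite big_split /= scaleNr [in RHS]addrCA addrC; congr (_ + _).
  by rewrite -[LHS]addr0 -[in LHS]comb0 addKr.
have : classical_sets.setI (hull (a |` F)) (hull (b |` F)) q.
  split.
    exists wa; split=> // x _; apply: mulr_ge0; first by rewrite invr_ge0 ltW.
    by case: ifP => _ //; rewrite oppr_ge0 ltW.
  exists wb; split=> // x; rewrite in_fset1U => xbF.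
  apply: mulr_ge0; first by rewrite invr_ge0 ltW.
  case: eqP xbF => [_ _|_ /= xF]; first exact: ltW.
  by rewrite -lerBlDl sub0r cM.
rewrite hullt => -[w [w0 sumw qt]].
pose w' x := if x \in t then w x else 0.
have big_t (V : nmodType) (G : R -> 'rV[R]_n -> V) : (forall x, G 0 x = 0) ->
    \sum_(x <- t) G (w x) x = \sum_(x <- a |` F) G (w' x) x.
  move=> G0.
  rewrite (eq_big_seq (fun x => G (w' x) x)) => [|x xt]; last by rewrite /w' xt.
  apply: big_fset_incl => // x _ xt.
  by rewrite /w' (negbTE xt).
have at' : a \notin t by apply/negP => /(fsubsetP tb); apply/negP.
have := indep (fun x => wa x - w' x).
rewrite sumrB sumwa -(big_t _ (fun r _ => r)) // sumw subrr => /(_ erefl).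
under eq_bigr do rewrite scalerBl.
rewrite sumrB -(big_t _ (fun r x => r *: x)) => [|x]; last by rewrite scale0r.
rewrite -qt subrr => /(_ erefl a); rewrite !inE eqxx => /(_ isT).
rewrite /w' (negbTE at') subr0 /wa eqxx => /eqP.
by rewrite mulf_eq0 invr_eq0 oppr_eq0 (negbTE Wn0) lt_eqF.
Qed.



Lemma dependence_same_sign F a b (c : 'rV[R]_n -> R) :
  a \notin F -> b \notin F -> a != b -> affinely_independent (a |` F) ->
  (exists t, [/\ t `<=` a |` F, t `<=` b |` F
               & classical_sets.setI (hull (a |` F)) (hull (b |` F)) = hull t]) ->
  affine_dependence (a |` (b |` F)) c -> 0 <= c a * c b.
Proof.
move=> aF bF ab indep meet dep.
have sides := dependence_sides aF bF ab indep meet.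
have [ca|ca|->] := ltgtP (c a) 0; last by rewrite mul0r.
  by apply: mulr_le0; [exact: ltW | exact: sides].
have dep' : affine_dependence (a |` (b |` F)) (fun x => - c x).
  case: dep => sum0 comb0; split; first by rewrite sumrN sum0 oppr0.
  by under eq_bigr do rewrite scaleNr; rewrite sumrN comb0 oppr0.
have := sides _ dep'; rewrite oppr_lt0 oppr_le0 => /(_ ca) cb.
by apply: mulr_ge0; first exact: ltW.
Qed.

(** Without a, the dependence would be one of the vertices of a simplex. *)
Lemma dependence_coef_neq0 F a b (c : 'rV[R]_n -> R) :
  a \notin b |` F -> affinely_independent (b |` F) ->
  affine_dependence (a |` (b |` F)) c ->
  (exists2 x, x \in a |` (b |` F) & c x != 0) -> c a != 0.
Proof.
move=> abF indep [sum0 comb0] [x xv cx]; apply/eqP => ca.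
move: sum0 comb0; rewrite !(big_fsetU1 _ _ abF) /= ca scale0r !add0r => sum0 comb0.
have c0 := indep c sum0 comb0.
case/fset1UP: xv => [xa|xv]; first by rewrite xa ca eqxx in cx.
by rewrite (c0 x xv) eqxx in cx.
Qed.

(** There are only two sides. A dependence between F, a1, a2 and one between
    F, a2, a3 each have coefficients of equal strict sign at the two apexes;
    eliminating a2 gives a dependence between F, a1, a3 with opposite signs at
    a1 and a3. *)
Lemma no_three_cofaces F (a1 a2 a3 : 'rV[R]_n) :
  #|` F| = n -> a1 \notin F -> a2 \notin F -> a3 \notin F ->
  a1 != a2 -> a2 != a3 -> a1 != a3 ->
  (forall a, a \in [:: a1; a2; a3] -> affinely_independent (a |` F)) ->
  (forall a b, a \in [:: a1; a2; a3] -> b \in [:: a1; a2; a3] ->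
     exists t, [/\ t `<=` a |` F, t `<=` b |` F
                 & classical_sets.setI (hull (a |` F)) (hull (b |` F)) = hull t]) ->
  False.
Proof.
move=> cardF F1 F2 F3 n12 n23 n13 indep meet.
have dep a b : a \in [:: a1; a2; a3] -> b \in [:: a1; a2; a3] ->
    a \notin F -> b \notin F -> a != b ->
    exists2 c, affine_dependence (a |` (b |` F)) c & 0 < c a * c b.
  move=> ha hb aF bF ab.
  have abF : a \notin b |` F by rewrite in_fset1U negb_or ab.
  have baF : b \notin a |` F by rewrite in_fset1U negb_or eq_sym ab.
  have [|c cdep cn0] := @affine_dependence_exists (a |` (b |` F)).
    by rewrite !cardfsU1 abF bF cardF.
  exists c => //; rewrite lt0r mulf_neq0; first last.
  - apply: (dependence_coef_neq0 baF); rewrite ?(fsetUCA [fset b]) //.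
    exact: indep.
  - by apply: (dependence_coef_neq0 abF) => //; exact: indep.
  - apply: (dependence_same_sign aF bF ab) => //; [exact: indep|exact: meet].
have i1 : a1 \in [:: a1; a2; a3] by rewrite !inE eqxx.
have i2 : a2 \in [:: a1; a2; a3] by rewrite !inE eqxx orbT.
have i3 : a3 \in [:: a1; a2; a3] by rewrite !inE eqxx !orbT.
have [u [su cu] u12] := dep _ _ i1 i2 F1 F2 n12.
have [v [sv cv] v23] := dep _ _ i2 i3 F2 F3 n23.
pose w x := if x == a1 then u a1 * v a2 else if x == a3 then - (u a2 * v a3)
  else v a2 * u x - u a2 * v x.
have wF x : x \in F -> w x = v a2 * u x - u a2 * v x.
  move=> xF; rewrite /w ifN ?ifN //; first by apply: contraNneq F3 => <-.
  by apply: contraNneq F1 => <-.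
have w1 : w a1 = u a1 * v a2 by rewrite /w eqxx.
have w3 : w a3 = - (u a2 * v a3) by rewrite /w eq_sym (negbTE n13) eqxx.
have N12 : a1 \notin a2 |` F by rewrite in_fset1U negb_or n12.
have N23 : a2 \notin a3 |` F by rewrite in_fset1U negb_or n23.
have N13 : a1 \notin a3 |` F by rewrite in_fset1U negb_or n13.
have wdep : affine_dependence (a1 |` (a3 |` F)) w.
  split; rewrite (big_fsetU1 _ _ N13) (big_fsetU1 _ _ F3) /= w1 w3.
    rewrite (eq_big_seq _ wF) sumrB -!mulr_sumr.
    move: su sv; rewrite (big_fsetU1 _ _ N12) (big_fsetU1 _ _ F2) /=.
    rewrite (big_fsetU1 _ _ N23) (big_fsetU1 _ _ F3) /=.
    move: (\sum_(i <- F) u i) (\sum_(i <- F) v i) => U V hU hV.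
    have -> : U = - (u a1 + u a2) by lra.
    have -> : V = - (v a2 + v a3) by lra.
    by ring.
  rewrite (eq_big_seq (fun x => v a2 *: (u x *: x) - u a2 *: (v x *: x))).
    move: cu cv; rewrite (big_fsetU1 _ _ N12) (big_fsetU1 _ _ F2) /=.
    rewrite (big_fsetU1 _ _ N23) (big_fsetU1 _ _ F3) /=.
    rewrite sumrB -!scaler_sumr.
    move: (\sum_(i <- F) u i *: i) (\sum_(i <- F) v i *: i) => U V.
    rewrite addrA addrC => /eqP; rewrite addr_eq0 => /eqP ->.
    rewrite addrA addrC => /eqP; rewrite addr_eq0 => /eqP ->.
    by apply/rowP => i; rewrite !mxE; ring.
  by move=> x /wF ->; rewrite scalerBl !scalerA.
have := dependence_same_sign F1 F3 n13 (indep _ i1) (meet _ _ i1 i3) wdep.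
rewrite leNgt w1 w3 => /negP; apply.
have -> : u a1 * v a2 * - (u a2 * v a3) = - ((u a1 * u a2) * (v a2 * v a3)) by ring.
by rewrite oppr_lt0 mulr_gt0.
Qed.

End AffineGeometry.
(** * Interval summands of a persistence module *)

Section IntervalSummands.
Local Open Scope ring_scope.
Variables (F : fieldType) (K : nat).

Lemma interval_summand_projection (D : seq (nat * option nat)) b d :
  (b, d) \in D ->
  exists p : forall k : 'I_K.+1,
      pm_bigsum [seq interval_module F K bd.1 bd.2 | bd <- D] k ->
      interval_module F K b d k,
    (forall k y, exists x, p k x = y) /\
    (forall (j k : 'I_K.+1) (h : (j <= k)%N) x,
       p k (pm_map _ h x) = pm_map _ h (p j x)).
Proof.
elim: D => //= bd D IH; rewrite inE => /predU1P[<-|/IH[p [psurj pnat]]].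
  exists (fun k x => x.1); split=> // k y; by exists (y, 0).
exists (fun k x => p k x.2); split=> [k y|j k h x]; last exact: pnat.
by have [x <-] := psurj k y; exists (0, x).
Qed.

Lemma interval_map_neq0 (b d : bool) : b -> d ->
  (const_mx 1 : 'rV[F]_b) *m (pid_mx 1 : 'M_(b, d)) != 0.
Proof.
case: b => // _; case: d => // _.
rewrite pid_mx_1 mulmx1; apply/eqP => /rowP/(_ 0)/eqP.
by rewrite !mxE oner_eq0.
Qed.

(** Lift the generator of I(b, d): projected back to this summand, its image at
    kd is nonzero, whereas anything coming from kp < b projects to zero. *)
Lemma diagram_class_persists (M : persmod F K) D b d
    (kp kb kd : 'I_K.+1) (hp : (kp <= kd)%N) (hb : (kb <= kd)%N) :
  is_persistence_diagram M D -> (b, Some d) \in D ->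
  (kp < b)%N -> (b <= kb)%N -> (kd < d)%N ->
  exists x : M kb, forall x' : M kp, pm_map M hb x <> pm_map M hp x'.
Proof.
move=> [_ [f [fbij fnat]]] bdD kpb bkb kdd.
have [p [psurj pnat]] := interval_summand_projection bdD.
have [u uE] := psurj kb (const_mx 1).
have [g _ fK] := fbij kb.
exists (g u) => x' /(congr1 (f kd)) /(congr1 (p kd)).
rewrite !fnat !pnat fK uE /= => /eqP; apply/negP.
have ap : alive b (Some d) kp = false by rewrite /alive leqNgt kpb.
have -> : p kp (f kp x') = 0.
  by move: (p kp (f kp x')) => /=; rewrite ap => y; rewrite [y]thinmx0.
rewrite mul0mx; apply: interval_map_neq0; rewrite /= /alive.
  by rewrite bkb (leq_ltn_trans hb kdd).
by rewrite kdd (leq_trans bkb hb).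
Qed.

End IntervalSummands.

(** * Chains and boundaries *)

Section ChainComplex.
Local Open Scope fset_scope.
Local Open Scope ring_scope.
Variables (T : choiceType) (K : nat) (s : 'I_K -> {fset T}).
Implicit Types (w z : 'rV['F_2]_K) (m k : nat) (i j l : 'I_K).

Lemma chainsP m k z :
  reflect (forall i, z 0 i != 0 -> is_simplex_of_dim s m i /\ (i < k)%N)
          (z \in chains s m k).
Proof.
apply: (iffP idP) => [/memv_sumP[v vP ->] i|zP].
  rewrite summxE => /eqP zi.
  have : [exists j, [&& is_simplex_of_dim s m j, (j < k)%N & v j 0 i != 0]].
    apply/negbNE/negP => /existsPn vi; apply: zi; apply: big1 => j /andP[jm jk].
    by have := vi j; rewrite jm jk /= => /negbNE/eqP.
  case/existsP=> j /and3P[jm jk].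
  have /vlineP[a ->] := vP j (introT andP (conj jm jk)).
  by rewrite !mxE eqxx /= mulf_eq0 negb_or => /andP[_]; case: (i =P j) => // ->.
rewrite [z]row_sum_delta; apply: memv_suml => i _.
have [->|/zP[im ik]] := eqVneq (z 0 i) 0; first by rewrite scale0r mem0v.
apply: memvZ; apply: (subvP _ _ (memv_line _)).
by apply: (sumv_sup i) => //; rewrite im ik.
Qed.

Lemma boundaryE z j : boundary s z 0 j = \sum_i z 0 i * (is_facet s j i)%:R.
Proof. by rewrite lfunE /= mxE; apply: eq_bigr => i _; rewrite mxE. Qed.

Lemma boundary_support z j :
  boundary s z 0 j != 0 -> exists2 i, z 0 i != 0 & is_facet s j i.
Proof.
rewrite boundaryE => zj.
have [/existsP[i /andP[zi ji]]|/existsPn no] :=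
  boolP [exists i, (z 0 i != 0) && is_facet s j i]; first by exists i.
move: zj; rewrite big1 ?eqxx // => i _; have := no i.
by case: (is_facet _ _ _); rewrite ?mulr0 // andbT => /negbNE/eqP->; rewrite mul0r.
Qed.

Lemma simplex_coefE (i : 'I_K) z : simplex_coef i.+1 z = z 0 i.
Proof. by rewrite /simplex_coef (big_pred1 i). Qed.

Lemma simplex_coef_neq0 k z :
  simplex_coef k z != 0 -> exists2 i : 'I_K, i.+1 = k & z 0 i != 0.
Proof.
move=> zk; have [i /eqP ik|noi] := pickP [pred i : 'I_K | i.+1 == k].
  by exists i => //; move: zk; rewrite -ik simplex_coefE.
by rewrite /simplex_coef big_pred0 ?eqxx in zk.
Qed.

Lemma facetP j i :
  reflect (exists2 a, a \notin s j & s i = a |` s j) (is_facet s j i).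
Proof.
apply: (iffP andP) => [[ji /eqP ci]|[a aj ->]]; last first.
  by rewrite fsubsetUr cardfsU1 aj.
have : #|` s i `\` s j| == 1%N.
  by rewrite -(eqn_add2l #|` s j|) cardfsDS // ci subSnn addn1.
case/cardfs1P=> a Ea; exists a.
  by have := in_fset1 a a; rewrite -Ea eqxx inE => /andP[].
by rewrite -{1}(fsetID (s j) (s i)) (fsetIidPr ji) Ea fsetUC.
Qed.

Lemma facet_dim m j i :
  is_facet s j i -> is_simplex_of_dim s m j = is_simplex_of_dim s m.+1 i.
Proof.
by case/facetP=> a aj si; rewrite /is_simplex_of_dim si cardfsU1 aj eqSS.
Qed.

Hypothesis s_inj : injective s.
Hypothesis s_closed : forall i (t : {fset T}),
  t `<=` s i -> t != fset0 -> exists j, s j = t.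

(** If l has codimension 2 in i, then i = l + {x, y}, and exactly l + {x} and
    l + {y} lie between them. *)
Lemma boundary_boundary w : boundary s (boundary s w) = 0.
Proof.
apply/rowP => l; rewrite boundaryE mxE.
under eq_bigr do rewrite boundaryE mulr_suml.
rewrite exchange_big big1 //= => i _.
under eq_bigr do rewrite -mulrA -natrM mulnb.
rewrite -mulr_sumr; apply/eqP; rewrite mulf_eq0; apply/orP; right.
pose J := [set j | is_facet s j i && is_facet s l j]%SET.
have -> : \sum_j (is_facet s j i && is_facet s l j)%:R = #|J|%:R :> 'F_2.
  by rewrite -natr_sum -sum1dep_card [in RHS]big_mkcond.
have [->|[j]] := set_0Vmem J; first by rewrite cards0.
rewrite inE => /andP[/facetP[y yj si] /facetP[x xl sj]].
have yl : y \notin s l by apply: contra yj; rewrite sj; exact: fset1Ur.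
have yx : y != x by apply: contraNneq yj => ->; rewrite sj fset1U1.
have siE : s i = x |` (y |` s l) by rewrite si sj fsetUCA.
have [j' sj'] : exists j', s j' = y |` s l.
  by apply: (@s_closed i); [rewrite siE fsubsetUr | apply/fset0Pn; exists y; exact: fset1U1].
suff -> : J = [set j; j']%SET.
  rewrite cards2 (_ : j != j') //; apply: contraNneq xl => jj'.
  have : x \in s j' by rewrite -jj' sj fset1U1.
  by rewrite sj' in_fset1U eq_sym (negbTE yx).
apply/setP => k; rewrite !inE; apply/andP/orP => [[/facetP[u uk sk] /facetP[v vl skv]]|].
  have : v \in s i by rewrite sk skv !inE eqxx orbT.
  rewrite siE !in_fset1U (negbTE vl) orbF => /orP[]/eqP vE; [left|right]; apply/eqP/s_inj.
    by rewrite skv sj vE.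
  by rewrite skv sj' vE.
case=> /eqP->; split; apply/facetP.
- by exists y.
- by exists x.
- by exists x; rewrite ?siE ?sj' // in_fset1U negb_or eq_sym yx.
- by exists y.
Qed.

(** Were sigma_b in the boundary of w, subtracting a multiple of this boundary
    would turn any cycle of X_b into a homologous cycle of X_(b-1), and no
    class of X_(d-1) could be born at b. *)
Lemma born_cycle_not_killed_before m b d (D : seq (nat * option nat)) w :
  is_persistence_diagram (persistent_homology s m) D -> (b, Some d) \in D ->
  w \in chains s m.+1 d.-1 -> boundary s w \in chains s m b ->
  simplex_coef b (boundary s w) = 0.
Proof.
move=> diag bdD wd wb; apply/eqP/negbNE/negP => /simplex_coef_neq0[i ib wi].
have [_ /andP[bd dK]] := diag.1 _ _ bdD.
have iK : (i < K.+1)%N by rewrite ltnW // ltnS.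
have bK : (b < K.+1)%N by rewrite -ib ltnS.
have dK' : (d.-1 < K.+1)%N by rewrite (leq_ltn_trans (leq_pred d)).
have hp : (i <= d.-1)%N by case: (d) bd => // e; rewrite -ib ltnS; apply: ltnW.
have hb : (b <= d.-1)%N by case: (d) bd.
have [] := @diagram_class_persists _ _ _ D b d (Ordinal iK) (Ordinal bK)
  (Ordinal dK') hp hb diag bdD.
- by rewrite /= -ib.
- by [].
- by rewrite /= ltn_predL; case: (d) bd.
move=> x noimage.
pose c := repr x.
pose v := vsval c - (vsval c 0 i / boundary s w 0 i) *: boundary s w.
have cC : vsval c \in cycles s m b by apply: subvsP.
have vC : v \in cycles s m i.
  have [/chainsP cb cker] : vsval c \in chains s m b /\ boundary s (vsval c) = 0.
    by move: cC; rewrite memv_cap memv_ker => /andP[-> /eqP].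
  rewrite memv_cap memv_ker; apply/andP; split; last first.
    by rewrite /v linearB linearZ /= cker boundary_boundary scaler0 subr0.
  apply/chainsP => j; rewrite !mxE => vj.
  have [jm jb] : is_simplex_of_dim s m j /\ (j < b)%N.
    have [cj|/cb //] := eqVneq (vsval c 0 j) 0.
    apply: ((chainsP _ _ _) wb); apply: contraNneq vj => bj.
    by rewrite cj bj mulr0 subr0.
  split=> //; move: jb; rewrite -ib ltnS leq_eqVlt => /orP[/eqP/val_inj ji|//].
  by rewrite ji divfK // subrr eqxx in vj.
have wv : vsval c - v \in boundaries s m d.-1.
  by rewrite /v opprB addrC subrK memvZ // memv_img.
(* The body of [v] is forgotten: simplification must not distribute the
   projection [vsproj], which is only inverted on [v] itself. *)
move: v vC wv => v vC wv.
apply: (noimage (quot_pi _ (vsproj (cycles s m i) v))).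
rewrite -[x]quot_reprK /= !quot_map_pi; apply/quot_pi_eq.
rewrite -memv_preim lfunE linearB /= !vsprojK //.
  exact: (subvP (cyclesS s m hp)).
exact: (subvP (cyclesS s m hb)).
Qed.

(** * Optimal volumes as components of the dual graph *)

Hypothesis facet_before : forall i j, is_facet s j i -> (j < i)%N.

(** The ordinal e stands for sigma_(e+1), so b <= e means that the filtration
    index of the common facet is > b. *)
Definition dual_adj (m b : nat) : rel 'I_K := fun i i' =>
  [&& is_simplex_of_dim s m i, is_simplex_of_dim s m i' &
   [exists e : 'I_K, [&& (b <= e)%N, is_facet s e i & is_facet s e i']]].

Lemma dual_adj_sym m b : symmetric (dual_adj m b).
Proof.
move=> i i'; rewrite /dual_adj andbCA; congr [&& _, _ & _].
by apply: eq_existsb => e; rewrite [is_facet _ _ i && _]andbC.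
Qed.

Lemma dual_connect_mono m b b' i i' : (b <= b')%N ->
  connect (dual_adj m b') i i' -> connect (dual_adj m b) i i'.
Proof.
move=> bb'; apply: connect_sub i i' => i i' /and3P[im im' /existsP[e]].
case/and3P=> be ei ei'; apply: connect1; rewrite /dual_adj im im' /=.
by apply/existsP; exists e; rewrite (leq_trans bb' be) ei.
Qed.

Variable m : nat.
Hypothesis two_cofaces : forall j i1 i2 i3, is_simplex_of_dim s m j ->
  is_facet s j i1 -> is_facet s j i2 -> is_facet s j i3 ->
  [|| i1 == i2, i2 == i3 | i1 == i3].

Lemma boundary_two_cofaces z j i i' : is_simplex_of_dim s m j ->
  is_facet s j i -> is_facet s j i' -> i != i' ->
  boundary s z 0 j = z 0 i + z 0 i'.
Proof.
move=> jm ji ji' ii'; rewrite boundaryE (bigD1 i) // (bigD1 i') 1?eq_sym //=.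
rewrite ji ji' !mulr1 big1 ?addr0 // => k /andP[ki ki'].
case jk : (is_facet s j k); last by rewrite mulr0.
have := two_cofaces jm ji ji' jk.
by rewrite (negbTE ii') eq_sym (negbTE ki') eq_sym (negbTE ki).
Qed.

Definition chain_restrict (C : {set 'I_K}) z : 'rV['F_2]_K :=
  \row_i (if i \in C then z 0 i else 0).

(** The cofaces of j are pairwise adjacent, so either all of them are in C or
    none is. *)
Lemma boundary_restrict b (C : {set 'I_K}) z j :
  (forall i i', dual_adj m.+1 b i i' -> i \in C -> i' \in C) ->
  is_simplex_of_dim s m j -> (b <= j)%N ->
  boundary s (chain_restrict C z) 0 j = boundary s z 0 j \/
  boundary s (chain_restrict C z) 0 j = 0.
Proof.
move=> Cclosed jm bj; rewrite !boundaryE.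
have [/existsP[i /andP[iC ji]]|/existsPn noC] :=
  boolP [exists i, (i \in C) && is_facet s j i]; [left|right]; last first.
  apply: big1 => i _; have := noC i; rewrite mxE.
  by case: (i \in C) => /= [/negbTE ->|_]; rewrite ?mulr0 ?mul0r.
apply: eq_bigr => i' _; rewrite mxE.
case ji' : (is_facet s j i'); last by rewrite !mulr0.
rewrite (Cclosed i) // /dual_adj -!(facet_dim _ ji, facet_dim _ ji') jm /=.
by apply/existsP; exists j; rewrite bj ji ji'.
Qed.

(** The coefficients alpha_k can only be the coordinates of z, which turns the
    definition into conditions on these coordinates. *)
Lemma persistent_volumeP b d (i0 : 'I_K) z : i0.+1 = d ->
  is_persistent_volume s m.+1 b d z <->
  [/\ z 0 i0 = 1,
      forall i, z 0 i != 0 ->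
        is_simplex_of_dim s m.+1 i /\ (i = i0 \/ (b < i.+1 < d)%N),
      forall j, is_simplex_of_dim s m j -> (b < j.+1 < d)%N ->
        boundary s z 0 j = 0
    & simplex_coef b (boundary s z) != 0].
Proof.
move=> i0d; have coefE (a : 'I_K -> 'F_2) i :
    (simplex_chain K d + \sum_(j in simplices_between s m.+1 b d)
      a j *: simplex_chain K j.+1) 0 i =
    (i == i0)%:R + (if i \in simplices_between s m.+1 b d then a i else 0).
  rewrite !mxE -i0d eqSS; congr (_ + _).
  rewrite summxE big_mkcond (bigD1 i) //= big1 ?addr0 => [|j ji].
    by case: ifP => // _; rewrite !mxE eqxx mulr1.
  case: ifP => // _; rewrite !mxE eqSS (_ : _ == _ = false) ?mulr0 //.
  by apply/negbTE; rewrite eq_sym.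
have i0N : i0 \in simplices_between s m.+1 b d = false.
  by rewrite inE i0d ltnn !andbF.
split=> [[/chainsP zn [a zE] zb zc]|[z1 zn zb zc]]; split=> //.
- by rewrite zE coefE eqxx i0N addr0.
- move=> i zi; have [iD _] := zn i zi; split=> //.
  move: zi; rewrite zE coefE; have [->|_] := eqVneq i i0; first by left.
  by rewrite add0r; case: ifP => [|_ /eqP//]; rewrite inE => /andP[]; right.
- by move=> j jm jb; rewrite -simplex_coefE; apply: zb; rewrite inE jm jb.
- by apply/chainsP => i /zn[].
- exists (fun i => z 0 i); apply/rowP => i; rewrite coefE.
  have [->|ii0] := eqVneq i i0; first by rewrite z1 i0N addr0.
  rewrite add0r; case: ifP => // /negP iN; apply/eqP/negbNE/negP => zi; apply: iN.
  have [iD [/eqP|ib]] := zn i zi; first by rewrite (negbTE ii0).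
  by rewrite inE iD ib.
- by move=> j; rewrite inE simplex_coefE => /andP[]; apply: zb.
Qed.

(** The component C is contained in z, and z restricted to C is already a
    persistent volume: its boundary contains sigma_b, since otherwise the rest
    of z would bound a cycle through sigma_b before d. *)
Lemma optimal_volume_component (D : seq (nat * option nat)) b d z :
  is_persistence_diagram (persistent_homology s m) D -> (b, Some d) \in D ->
  is_optimal_volume s m.+1 b d z ->
  exists i0 : 'I_K, simplices_of_chain s m.+1 z =
    [set i | connect (dual_adj m.+1 b) i0 i]%SET.
Proof.
move=> diag bdD [zvol zmin].
have [_ /andP[bd dK]] := diag.1 _ _ bdD.
have d0 : (0 < d)%N by apply: leq_ltn_trans bd.
have i0K : (d.-1 < K)%N by rewrite prednK.
pose i0 := Ordinal i0K; have i0d : i0.+1 = d by rewrite /= prednK.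
exists i0.
set C := [set i | _]%SET; set S := simplices_of_chain s m.+1 z.
have [z1 zn zb zc] := (persistent_volumeP b z i0d).1 zvol.
have SE i : (i \in S) = (z 0 i != 0).
  rewrite inE; apply/andP/idP => [[]//|zi]; split=> //; exact: (zn i zi).1.
have Slt i : i \in S -> (i < d)%N.
  by rewrite SE => /zn[_ [->|/andP[_ /ltnW]]]; rewrite // i0d.
have adj_closed i i' : dual_adj m.+1 b i i' -> i \in S -> i' \in S.
  case/and3P=> im im' /existsP[j /and3P[bj ji ji']] iS.
  have [<- //|ii'] := eqVneq i i'.
  have jm : is_simplex_of_dim s m j by rewrite (facet_dim _ ji).
  have := boundary_two_cofaces z jm ji ji' ii'.
  rewrite zb //; last by rewrite ltnS bj (leq_ltn_trans (facet_before ji)) ?Slt.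
  move=> sum0; rewrite SE; apply: contraTneq iS => zi'.
  by rewrite SE negbK sum0 zi' addr0.
have adj_connect_sym : connect_sym (dual_adj m.+1 b).
  exact: (sym_connect_sym (@dual_adj_sym _ _)).
have CS : C \subset S.
  apply/fintype.subsetP => i; rewrite inE => i0i.
  rewrite -(closed_connect (intro_closed adj_connect_sym adj_closed) i0i).
  by rewrite SE z1 oner_eq0.
have Cclosed i i' : dual_adj m.+1 b i i' -> i \in C -> i' \in C.
  by rewrite !inE => ii' i0i; apply: connect_trans i0i (connect1 ii').
pose zC := chain_restrict C z.
have zCn i : zC 0 i != 0 -> z 0 i != 0 /\ i \in C.
  by rewrite mxE; case: ifP => // _ /eqP.
have i0C : i0 \in C by rewrite inE connect0.
have zCb j : is_simplex_of_dim s m j -> (b < j.+1 < d)%N -> boundary s zC 0 j = 0.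
  move=> jm jbd; have /andP[bj _] := jbd.
  by have [->|->] := boundary_restrict z Cclosed jm bj; rewrite ?zb.
have zCc : simplex_coef b (boundary s zC) != 0.
  apply/negP => /eqP zCc.
  have wn i : (z - zC) 0 i != 0 -> is_simplex_of_dim s m.+1 i /\ (i < d.-1)%N.
    rewrite !mxE; case: ifPn => [_|iC]; first by rewrite subrr eqxx.
    rewrite subr0 => /zn[im [ii0|/andP[_ id]]]; first by rewrite ii0 i0C in iC.
    by split=> //; rewrite -ltnS prednK.
  have wb : boundary s (z - zC) \in chains s m b.
    apply/chainsP => j wj.
    have [i wi ji] : exists2 i, (z - zC) 0 i != 0 & is_facet s j i.
      exact: boundary_support.
    have [im id] := wn i wi.
    have jm : is_simplex_of_dim s m j by rewrite (facet_dim _ ji).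
    split=> //; rewrite ltnNge; apply: contra wj => bj.
    have jbd : (b < j.+1 < d)%N.
      by rewrite ltnS bj -(prednK d0) ltnS (ltn_trans (facet_before ji)).
    by rewrite linearB !mxE zb ?zCb // subr0.
  have /eqP := born_cycle_not_killed_before diag bdD (introT (chainsP _ _ _) wn) wb.
  have [e eb ze] := simplex_coef_neq0 zc.
  move: zCc; rewrite -eb !simplex_coefE linearB !mxE => ->.
  by rewrite subr0; apply/negP.
have zCvol : is_persistent_volume s m.+1 b d zC.
  apply/(persistent_volumeP b zC i0d); split=> //.
    by rewrite mxE i0C.
  by move=> i /zCn[/zn].
apply/esym/eqP; rewrite eqEcard CS; apply: leq_trans (zmin _ zCvol) _.
apply/subset_leq_card/fintype.subsetP => i; rewrite inE => /andP[_ /zCn[]] //.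
Qed.

End ChainComplex.
(** * Simplicial complexes in R^n *)

Section ComplexInSpace.
Local Open Scope fset_scope.
Variables (R : realType) (n K : nat) (s : 'I_K -> {fset 'rV[R]_n}).
Hypothesis s_inj : injective s.
Hypothesis X_complex : is_simplicial_complex (range s).

Lemma complex_face_closed i (t : {fset 'rV[R]_n}) :
  t `<=` s i -> t != fset0 -> exists j, s j = t.
Proof.
case: X_complex => _ faces _ ti /eqP t0.
by have [|j _ <-] := faces (s i) t _ ti t0; [exists i | exists j].
Qed.

Lemma filtration_facet_before i j :
  (forall k, (1 <= k <= K)%N -> is_subcomplex (stage s k) (range s)) ->
  is_facet s j i -> (j < i)%N.
Proof.
move=> filt /andP[ji /eqP card_i].
have [] := filt i.+1; first by rewrite ltn_ord.
move=> _ [_ faces _].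
have [sj0 _] : s j <> fset0 /\ affinely_independent (s j).
  by case: X_complex => + _ _; apply; exists j.
have [i' /= i'i /s_inj i'j] : stage s i.+1 (s j).
  by apply: (faces (s i)) => //; exists i => /=.
rewrite -i'j; move: i'i; rewrite ltnS leq_eqVlt => /orP[/eqP/val_inj i'E|//].
by move: card_i; rewrite -i'j i'E => /n_Sn.
Qed.

Lemma complex_two_cofaces j i1 i2 i3 : #|` s j| = n ->
  is_facet s j i1 -> is_facet s j i2 -> is_facet s j i3 ->
  [|| i1 == i2, i2 == i3 | i1 == i3].
Proof.
move=> cardj /facetP[a1 a1j s1] /facetP[a2 a2j s2] /facetP[a3 a3j s3].
apply: contraT; rewrite !negb_or => /and3P[n12 n23 n13].
have neq i i' a a' : s i = a |` s j -> s i' = a' |` s j -> i != i' -> a != a'.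
  by move=> si si'; apply: contraNneq => aa'; apply/eqP/s_inj; rewrite si si' aa'.
have simplexP a : a \in [:: a1; a2; a3] -> range s (a |` s j).
  by rewrite !inE => /or3P[]/eqP->; rewrite -?s1 -?s2 -?s3; eexists.
case: X_complex => indep _ meet; exfalso.
apply: (no_three_cofaces cardj a1j a2j a3j (neq _ _ _ _ s1 s2 n12)
  (neq _ _ _ _ s2 s3 n23) (neq _ _ _ _ s1 s3 n13)).
  by move=> a /simplexP/indep[].
by move=> a b /simplexP aX /simplexP bX; exact: meet.
Qed.

End ComplexInSpace.

Theorem theorem8 (R : realType) (n : nat) (hn : (1 <= n)%N)
  (K : nat) (s : 'I_K -> {fset 'rV[R]_n}) (s_inj : injective s)
  (X_complex : is_simplicial_complex (range s))
  (X_pure : is_pure (range s))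
  (X_convex : convex_set (polyhedron (range s)))
  (X_filtration : forall k : nat, (1 <= k <= K)%N ->
     is_subcomplex (stage s k) (range s))
  (D : seq (nat * option nat))
  (D_diagram : is_persistence_diagram (persistent_homology s n.-1) D)
  (bi di bj dj : nat)
  (hi : (bi, Some di) \in D) (hj : (bj, Some dj) \in D)
  (hij : (bi, di) <> (bj, dj))
  (zi zj : 'rV['F_2]_K)
  (zi_opt : is_optimal_volume s n bi di zi)
  (zj_opt : is_optimal_volume s n bj dj zj) :
  [\/ simplices_of_chain s n zi :&: simplices_of_chain s n zj = finset.set0,
      simplices_of_chain s n zi \subset simplices_of_chain s n zj
    | simplices_of_chain s n zj \subset simplices_of_chain s n zi].
Proof.
case: n hn s s_inj X_complex X_pure X_convex X_filtration D_diagram zi zj zi_opt zj_opt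
  => // m _ {}s s_inj X_complex _ _ X_filtration diag zi zj zi_opt zj_opt.
have before i j := filtration_facet_before s_inj X_complex X_filtration (i := i) (j := j).
have cofaces j i1 i2 i3 (jm : is_simplex_of_dim s m j) :=
  complex_two_cofaces s_inj X_complex (eqP jm) (i1 := i1) (i2 := i2) (i3 := i3).
have component := optimal_volume_component s_inj
  (complex_face_closed X_complex) before cofaces diag.
have [i0 ->] := component _ _ _ hi zi_opt.
have [j0 ->] := component _ _ _ hj zj_opt.
have nested b b' x y : (b <= b')%N ->
    let C := [set k | connect (dual_adj s m.+1 b) x k]%SET in
    let C' := [set k | connect (dual_adj s m.+1 b') y k]%SET in
    C :&: C' = finset.set0 \/ C' \subset C.
  move=> bb' C C'; have [->|[k]] := set_0Vmem (C :&: C'); first by left.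
  rewrite !inE => /andP[xk yk]; right; apply/fintype.subsetP => l; rewrite !inE => yl.
  apply: connect_trans xk (dual_connect_mono bb' _).
  apply: connect_trans yl.
  by rewrite (sym_connect_sym (@dual_adj_sym _ _ s _ _)).
have [bij|/ltnW bji] := leqP bi bj.
  by have [disj|sub] := nested _ _ i0 j0 bij; [apply: Or31 | apply: Or33].
have [disj|sub] := nested _ _ j0 i0 bji; [apply: Or31 | exact: Or32].
by rewrite finset.setIC.
Qed.
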